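(* Let $m \geq 1$ be an integer and let $q \in \mathbb{C}$ be any root of unity. Then $$\sum_{n_m \geq \dots \geq n_1 \geq 0} (q)_{n_m}(-1)^{n_1}q^{-\binom{n_1+1}{2}}\prod_{i=1}^{m-1} q^{n_i^2+n_i} \begin{bmatrix} n_{i+1} \\ n_i \end{bmatrix} = \sum_{n_m \geq \dots \geq n_1 \geq 0} (q)_{n_m}(q)_{n_1}q^{n_m+1}\prod_{i=1}^{m-1} q^{n_i^2+n_i} \begin{bmatrix} n_{i+1} \\ n_i \end{bmatrix},$$ where both sums run over all $m$-tuples of integers $(n_1,\dots,n_m)$ with $n_m \geq \cdots \geq n_1 \geq 0$.
   Context: For a non-negative integer $n$, $(a)_n = (a;q)_n = \prod_{k=0}^{n-1}(1-aq^k)$, so $(q)_n = \prod_{k=1}^{n}(1-q^k)$. The $q$-binomial coefficient (Gaussian polynomial) is $\begin{bmatrix} n \\ k \end{bmatrix} = \begin{bmatrix} n \\ k \end{bmatrix}_q = \frac{(q)_n}{(q)_{n-k}(q)_k}$ if $0 \leq k \leq n$ and $0$ otherwise; it is a polynomial in $q$, and at a root of unity it means the value of this polynomial. Empty products equal $1$. If $q$ is a primitive $N$th root of unity then $(q)_{n_m}=0$ for $n_m \geq N$, so both sums have only finitely many nonzero terms. *)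

(* Defs.v *)
From HB Require Import structures.
From mathcomp Require Import all_boot all_order all_algebra.
From mathcomp Require Import classical_sets functions cardinality fsbigop reals.
From mathcomp Require Export complex.

Set Implicit Arguments.
Unset Strict Implicit.
Unset Printing Implicit Defensive.

Import GRing.Theory.
Local Open Scope ring_scope.

Definition qpoch (R : comNzRingType) (a q : R) (n : nat) : R :=
  \prod_(0 <= k < n) (1 - a * q ^+ k).

Definition qfact (R : comNzRingType) (q : R) (n : nat) : R := qpoch q q n.

(* The quotient is taken between polynomials in the indeterminate, where it is
   exact (see gauss_polyK); only the result is evaluated, so that [qbinom]
   makes sense at roots of unity, where [qfact q] may vanish. *)
Definition gauss_poly (F : fieldType) (n k : nat) : {poly F} :=
  if (k <= n)%N then qfact 'X n %/ (qfact 'X (n - k) * qfact 'X k) else 0.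

Definition qbinom (F : fieldType) (q : F) (n k : nat) : F :=
  (gauss_poly F n k).[q].

(* Tuples are indexed from 0, the n_i of the statement from 1:
   [part n i] is n_i, for 1 <= i <= m. *)
Definition part (m : nat) (n : m.-tuple nat) (i : nat) : nat := nth 0%N n i.-1.

(* n_1 <= n_2 <= ... <= n_m *)
Definition chains (m : nat) : set (m.-tuple nat) :=
  [set n : m.-tuple nat | sorted leq n]%classic.
Arguments chains : clear implicits.

Definition chain_weight (F : fieldType) (q : F) (m : nat) (n : m.-tuple nat) : F :=
  \prod_(1 <= i < m)
    (q ^+ (part n i ^ 2 + part n i) * qbinom q (part n i.+1) (part n i)).

Lemma qfactS (R : comNzRingType) (q : R) n :
  qfact q n.+1 = qfact q n * (1 - q ^+ n.+1).
Proof. by rewrite /qfact /qpoch big_nat_recr //= -exprS. Qed.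

Lemma qfactX_neq0 (F : fieldType) n : qfact ('X : {poly F}) n != 0.
Proof.
elim: n => [|n IHn]; first by rewrite /qfact /qpoch big_geq ?oner_eq0.
rewrite qfactS mulf_neq0 // -oppr_eq0 opprB.
by rewrite -size_poly_gt0 -polyC1 size_XnsubC.
Qed.

Lemma dvdp_qfactX (F : fieldType) n k : (k <= n)%N ->
  qfact ('X : {poly F}) (n - k) * qfact 'X k %| qfact 'X n.
Proof.
have fact0 : qfact ('X : {poly F}) 0 = 1 by rewrite /qfact /qpoch big_geq.
elim: n k => [|n IHn] [|k] le_kn; rewrite ?subn0 ?fact0 ?mulr1 ?dvdpp //.
rewrite subSS; have [<-|neq_kn] := eqVneq k n.
  by rewrite subnn fact0 mul1r dvdpp.
have lt_kn : (k < n)%N by rewrite ltn_neqAle neq_kn.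
have -> : qfact ('X : {poly F}) n.+1 =
    (1 - 'X ^+ k.+1) * qfact 'X n + ('X ^+ k.+1 * (1 - 'X ^+ (n - k))) * qfact 'X n.
  rewrite -mulrDl mulrBr mulr1 -exprD addSn subnKC // addrA subrK.
  by rewrite qfactS mulrC.
rewrite dvdp_addl.
  rewrite qfactS mulrA mulrC dvdp_mul //.
  exact: IHn.
have -> : qfact ('X : {poly F}) (n - k) =
    (1 - 'X ^+ (n - k)) * qfact 'X (n - k.+1).
  by rewrite -[in LHS](subnSK lt_kn) qfactS subnSK // mulrC.
by rewrite -!mulrA dvdp_mull // dvdp_mul // IHn.
Qed.

Lemma gauss_polyK (F : fieldType) n k : (k <= n)%N ->
  gauss_poly F n k * (qfact 'X (n - k) * qfact 'X k) = qfact 'X n.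
Proof. by move=> le_kn; rewrite /gauss_poly le_kn divpK // dvdp_qfactX. Qed.

Lemma qfact_unity_root (F : fieldType) (q : F) N n :
  (0 < N)%N -> N.-unity_root q -> (N <= n)%N -> qfact q n = 0.
Proof.
case: N => // N _ /unity_rootP qN /subnK <-.
elim: (n - _)%N => [|d IHd]; last by rewrite addSn qfactS IHd mul0r.
by rewrite qfactS qN subrr mulr0.
Qed.

(* The sums [\sum_(n \in chains m) _] are 0 by convention when infinitely many
   terms are nonzero; this does not happen for summands with a factor
   (q)_(n_m). *)
Lemma finite_chain_support (F : fieldType) (q : F) N m (G : m.-tuple nat -> F) :
  (0 < m)%N -> (0 < N)%N -> N.-unity_root q ->
  finite_set (chains m `&` [set n | qfact q (part n m) * G n != 0])%classic.
Proof.
move=> m0 N0 qN.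
apply: (@sub_finite_set _ _
  ((fun t : m.-tuple 'I_N => map_tuple (@nat_of_ord N) t) @` setT)%classic).
  move=> n [/= sn nz].
  have ltN : (part n m < N)%N.
    by rewrite ltnNge; apply: contra nz => /(qfact_unity_root N0 qN)->; rewrite mul0r.
  have ltn_i i : (tnth n i < N)%N.
    apply: leq_ltn_trans ltN; rewrite (tnth_nth 0%N) /part.
    apply: (sorted_leq_nth leq_trans leqnn) => //; rewrite ?inE ?size_tuple //.
      by rewrite prednK.
    by rewrite -ltnS prednK.
  exists [tuple Ordinal (ltn_i i) | i < m] => //.
  by apply: eq_from_tnth => i; rewrite tnth_map tnth_mktuple.
exact/finite_image/finite_finset.
Qed.

(* Main.v *)
Require Import Defs.
From HB Require Import structures.
From mathcomp Require Import all_boot all_order all_algebra.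
From mathcomp Require Import classical_sets cardinality fsbigop reals complex.
From mathcomp Require Import ring.

Set Implicit Arguments.
Unset Strict Implicit.
Unset Printing Implicit Defensive.

Local Open Scope ring_scope.
Import GRing.Theory.

(** Write [M] for the linear operator [bailey_step],
      (M f)(n) = sum_(k <= n) q^(k^2 + k) [n, k] f(k),
    acting on sequences.  Summing a chain over its smallest entries first shows
    that, for all sequences [a] and [b], the sum over n_m >= ... >= n_1 >= 0 of
    (q)_(n_m) b(n_m) a(n_1) times the chain weight is
      sum_(n < N) (q)_n b(n) (M^(m-1) a)(n);
    the cutoff N is harmless because (q)_n = 0 for n >= N ([fsum_chains]).
    With f(n) = (-1)^n q^(-binom(n+1, 2)), the two sides of the theorem are thus
      sum_n (q)_n (M^(m-1) f)(n)   and
      sum_n (q)_n q^(n+1) (M^(m-1) (q)_.)(n),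
    and they agree because one extra factor M can be absorbed at either end:
    - at the start of the chain M f = (q)_., for every q <> 0; this is a special
      case of the q-binomial theorem ([bailey_step_alternating]);
    - at the end of the chain, the row vector (q)_n q^(n+1) times M is the row
      vector (q)_k, as soon as (q)_N = 0 ([sum_last_bailey_step]).
    Hence both sides equal sum_n (q)_n q^(n+1) (M^m f)(n). *)

(** * Gaussian polynomials *)

Lemma qfact0 (R : comNzRingType) (q : R) : qfact q 0 = 1.
Proof. by rewrite /qfact /qpoch big_geq. Qed.

Lemma telescope_sum_ord (V : zmodType) (f : nat -> V) n :
  \sum_(i < n) (f i.+1 - f i) = f n - f 0%N.
Proof. by rewrite -(telescope_sumr f (leq0n n)) big_mkord. Qed.

Lemma gauss_poly_gt (F : fieldType) n k : (n < k)%N -> gauss_poly F n k = 0.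
Proof. by rewrite /gauss_poly ltnNge; case: leqP. Qed.

Lemma gauss_polynn (F : fieldType) n : gauss_poly F n n = 1.
Proof.
by rewrite /gauss_poly leqnn subnn qfact0 mul1r divpp // qfactX_neq0.
Qed.

Lemma gauss_polyn0 (F : fieldType) n : gauss_poly F n 0 = 1.
Proof. by rewrite /gauss_poly leq0n subn0 qfact0 mulr1 divpp // qfactX_neq0. Qed.

(** The Pascal rules are proved for polynomials, where the factors (q)_n can be
    cancelled, and only then evaluated at a possibly singular point. *)
Lemma gauss_poly_shift (F : fieldType) n k :
  (1 - 'X ^+ k.+1) * gauss_poly F n k.+1 = (1 - 'X ^+ (n - k)) * gauss_poly F n k.
Proof.
have [lt_kn | lt_nk | <-] := ltngtP k n; first last.
- by rewrite gauss_poly_gt // subnn subrr mul0r mulr0.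
- by rewrite !gauss_poly_gt ?mulr0 // ltnS ltnW.
pose c : {poly F} := qfact 'X (n - k.+1) * qfact 'X k.
have c0 : c != 0 by rewrite mulf_neq0 ?qfactX_neq0.
apply: (mulIf c0).
have := gauss_polyK F lt_kn; have := gauss_polyK F (ltnW lt_kn).
rewrite -(subnSK lt_kn) !qfactS /c => <- E.
by apply: (etrans (etrans _ E)); ring.
Qed.

Lemma gauss_polyS (F : fieldType) n k :
  gauss_poly F n.+1 k.+1 = gauss_poly F n k.+1 + 'X ^+ (n - k) * gauss_poly F n k.
Proof.
have [lt_kn | lt_nk | <-] := ltngtP k n; first last.
- by rewrite !gauss_polynn gauss_poly_gt // subnn mul1r add0r.
- by rewrite !gauss_poly_gt ?mulr0 ?addr0 // ltnS ltnW.
pose c : {poly F} := qfact 'X (n - k) * qfact 'X k.+1.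
have c0 : c != 0 by rewrite mulf_neq0 ?qfactX_neq0.
apply: (mulIf c0).
have E := gauss_poly_shift F n k.
have E1 := gauss_polyK F (ltnW lt_kn).
have := gauss_polyK F (leq_trans lt_kn (leqnSn n) : (k.+1 <= n.+1)%N).
rewrite subSS -/c qfactS -E1 => ->.
have En : 'X ^+ n.+1 = 'X ^+ (n - k) * 'X ^+ k.+1 :> {poly F}.
  by rewrite -exprD addnS subnK // ltnW.
transitivity (qfact 'X (n - k) * qfact 'X k
    * ((1 - 'X ^+ (n - k)) * gauss_poly F n k
       + 'X ^+ (n - k) * (1 - 'X ^+ k.+1) * gauss_poly F n k)).
  by rewrite En; ring.
by rewrite -E /c qfactS; ring.
Qed.

(** * The two absorption identities *)

Section QBinomial.
Variables (F : fieldType) (q : F).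

Lemma qbinom_gt n k : (n < k)%N -> qbinom q n k = 0.
Proof. by move=> lt_nk; rewrite /qbinom gauss_poly_gt // horner0. Qed.

Lemma qbinomn0 n : qbinom q n 0 = 1.
Proof. by rewrite /qbinom gauss_polyn0 hornerC. Qed.

Lemma qbinom_shift n k :
  (1 - q ^+ k.+1) * qbinom q n k.+1 = (1 - q ^+ (n - k)) * qbinom q n k.
Proof.
by have := congr1 (horner^~ q) (gauss_poly_shift F n k); rewrite !hornerE.
Qed.

Lemma qbinomS n k :
  qbinom q n.+1 k.+1 = qbinom q n k.+1 + q ^+ (n - k) * qbinom q n k.
Proof. by rewrite /qbinom gauss_polyS !hornerE. Qed.

(** Since [n - k] is truncated, q^(n-k) q^k = q^n fails for k > n; the
    coefficient [n, k] vanishes precisely then, and sums need no case split. *)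
Lemma qbinom_exp n k : q ^+ (n - k) * q ^+ k * qbinom q n k = q ^+ n * qbinom q n k.
Proof.
case: (leqP k n) => [le_kn | lt_nk]; first by rewrite -exprD subnK.
by rewrite qbinom_gt // !mulr0.
Qed.

(** The q-binomial expansion of (z)_n at z = q: the Pascal rule turns the sum for
    n + 1 into the sum for n minus q^(n+1) times itself. *)
Lemma sum_alternating_qbinom n :
  \sum_(k < n.+1) (-1) ^+ k * q ^+ 'C(k.+1, 2) * qbinom q n k = qfact q n.
Proof.
elim: n => [|n IHn]; first by rewrite big_ord1 qfact0 qbinomn0 !mul1r.
rewrite big_ord_recl qbinomn0.
under eq_bigr => i _ do rewrite lift0 qbinomS mulrDr.
rewrite big_split /= addrA.
have -> : (-1) ^+ 0 * q ^+ 'C(1, 2) * 1 +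
    \sum_(i < n.+1) (-1) ^+ i.+1 * q ^+ 'C(i.+2, 2) * qbinom q n i.+1 = qfact q n.
  rewrite -IHn [RHS]big_ord_recl big_ord_recr /= qbinomn0.
  by rewrite (qbinom_gt (ltnSn n)) mulr0 addr0.
have -> : \sum_(i < n.+1)
    (-1) ^+ i.+1 * q ^+ 'C(i.+2, 2) * (q ^+ (n - i) * qbinom q n i)
  = - q ^+ n.+1 * qfact q n.
  rewrite -IHn mulr_sumr; apply: eq_bigr => i _.
  rewrite binS bin1 exprD exprSr exprSr [q ^+ n.+1]exprS.
  transitivity (- q * (-1) ^+ i * q ^+ 'C(i.+1, 2)
      * (q ^+ (n - i) * q ^+ i * qbinom q n i)); first by ring.
  by rewrite qbinom_exp; ring.
by rewrite qfactS; ring.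
Qed.

(** The step of the Bailey chain relative to a = q, acting on the
    sequences (q)_n beta_n rather than on beta_n. *)
Definition bailey_step (f : nat -> F) (n : nat) : F :=
  \sum_(k < n.+1) q ^+ (k ^ 2 + k) * qbinom q n k * f k.

Lemma eq_bailey_step f g : f =1 g -> bailey_step f =1 bailey_step g.
Proof. by move=> fg n; apply: eq_bigr => k _; rewrite fg. Qed.

Lemma bailey_step_ord N f n : (n < N)%N ->
  bailey_step f n = \sum_(k < N) q ^+ (k ^ 2 + k) * qbinom q n k * f k.
Proof.
move=> lt_nN; rewrite /bailey_step.
rewrite (big_ord_widen N (fun k => q ^+ (k ^ 2 + k) * qbinom q n k * f k)) //.
rewrite big_mkcond; apply: eq_bigr => k _.
by case: ltnP => // lt_nk; rewrite qbinom_gt // mulr0 mul0r.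
Qed.

(** Since k^2 + k = 2 binom(k+1, 2), the step replaces the negative power of q
    by the positive one of the alternating q-binomial sum. *)
Lemma bailey_step_alternating : q != 0 ->
  bailey_step (fun k => (-1) ^+ k * q ^- 'C(k.+1, 2)) =1 qfact q.
Proof.
move=> q0 n; rewrite -sum_alternating_qbinom; apply: eq_bigr => k _.
have -> : (k ^ 2 + k = 'C(k.+1, 2) + 'C(k.+1, 2))%N.
  by rewrite addnn -mul2n mul_bin_left bin1 subn1 -mulnn mulnSr.
rewrite exprD.
have c0 : q ^+ 'C(k.+1, 2) != 0 by rewrite expf_neq0.
by field.
Qed.

(** Induction on k.  Put t_k(n) = (q)_n q^(n+1) [n, k].  The Pascal rules give
      q^(k+1) (D(n+1) - D(n)) = (1 - q^(k+1)) t_k(n) - q^(2(k+1)) t_(k+1)(n)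
    with D(n) = (q)_n [n, k+1].  Summed over n < N the left side vanishes, because
    (q)_N = 0, and this gives the recurrence satisfied by (q)_k / q^(k^2 + k). *)
Lemma sum_last_bailey_step N k : qfact q N = 0 ->
  q ^+ (k ^ 2 + k) * (\sum_(n < N) qfact q n * q ^+ n.+1 * qbinom q n k)
  = qfact q k.
Proof.
move=> qN; elim: k => [|k IHk].
  rewrite mul1r qfact0.
  have tel n : qfact q n * q ^+ n.+1 * qbinom q n 0 = - (qfact q n.+1 - qfact q n).
    by rewrite qbinomn0 qfactS; ring.
  under eq_bigr => n _ do rewrite tel.
  by rewrite sumrN telescope_sum_ord qN qfact0; ring.
rewrite qfactS -IHk.
pose D n := qfact q n * qbinom q n k.+1.
have tel : \sum_(n < N) (D n.+1 - D n) = 0.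
  rewrite (telescope_sum_ord D) /D qN.
  by rewrite mul0r qbinom_gt // mulr0 subrr.
have : \sum_(n < N) ((1 - q ^+ k.+1) * (qfact q n * q ^+ n.+1 * qbinom q n k)
     - q ^+ k.+1 ^+ 2 * (qfact q n * q ^+ n.+1 * qbinom q n k.+1)) = 0.
  transitivity (q ^+ k.+1 * \sum_(n < N) (D n.+1 - D n)); last by rewrite tel mulr0.
  rewrite mulr_sumr; apply: eq_bigr => n _.
  rewrite /D qfactS qbinomS.
  (* What remains is a polynomial identity modulo the two linear relations
     between [n, k] and [n, k+1]. *)
  have := qbinom_exp n k; have := qbinom_shift n k; rewrite !exprS.
  move: (q ^+ (n - k)) (q ^+ n) (q ^+ k) (qbinom q n k) (qbinom q n k.+1).
  move=> a y x B B' E1 E2.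
  have {}E1 : q * x * B' = B' - (1 - a) * B by rewrite -E1; ring.
  transitivity (qfact q n * q * y
      * ((1 - q * x) * B - q * x * (q * x * B'))); first by ring.
  transitivity (qfact q n * q
      * ((1 - q * y) * (a * x * B) - q * x * y * B')); last by ring.
  transitivity (qfact q n * q * y
      * (B - q * x * B' - q * (a * x * B))); first by rewrite [in LHS]E1; ring.
  by rewrite E2; ring.
rewrite sumrB -!mulr_sumr => /subr0_eq E.
have -> : (k.+1 ^ 2 + k.+1 = k ^ 2 + k + k.+1 * 2)%N by ring.
by rewrite exprD exprM -mulrA -E; ring.
Qed.
End QBinomial.

(** * Chain sums as iterated steps *)

Section ChainSums.
Variables (F : fieldType) (q : F) (N : nat).

Lemma sum_tuple_cons (T : finType) (V : nmodType) m (G : m.+1.-tuple T -> V) :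
  \sum_t G t = \sum_(x : T) \sum_(t : m.-tuple T) G [tuple of x :: t].
Proof.
rewrite pair_big /= (reindex (fun p : T * m.-tuple T => [tuple of p.1 :: p.2])) //.
exists (fun t => (thead t, [tuple of behead t])) => [[x t] _ | t _] /=.
  by congr pair; apply: val_inj.
by rewrite -tuple_eta.
Qed.

Let vals m (t : m.-tuple 'I_N) : m.-tuple nat := map_tuple val t.

Lemma chain_weight_cons m (x : nat) (t : m.+1.-tuple nat) :
  chain_weight q [tuple of x :: t] =
  q ^+ (x ^ 2 + x) * qbinom q (part t 1) x * chain_weight q t.
Proof.
rewrite /chain_weight big_ltn // big_add1; congr (_ * _).
by apply: eq_big_nat => -[].
Qed.

(** Summing out the smallest entry of a chain replaces the weight [a] of that
    entry by its image under one step, and shortens the chain by one.  The order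
    condition is not imposed: the coefficients [n, k] with k > n vanish. *)
Lemma sum_tuple_bailey_step m (a b : nat -> F) :
  \sum_(t : m.+1.-tuple 'I_N)
     b (part (vals t) m.+1) * a (part (vals t) 1) * chain_weight q (vals t)
  = \sum_(n < N) b n * iter m (bailey_step q) a n.
Proof.
elim: m a => [|m IHm] a; rewrite sum_tuple_cons.
  apply: eq_bigr => n _; rewrite (big_pred1 [tuple]); last first.
    by move=> t; rewrite [t]tuple0 /= eqxx.
  by rewrite /chain_weight big_geq // mulr1.
rewrite iterSr -IHm exchange_big; apply: eq_bigr => t _.
have lt_tN : (part (vals t) 1 < N)%N by case/tupleP: t => x t; exact: ltn_ord.
rewrite (@bailey_step_ord _ _ N) // mulr_sumr mulr_suml; apply: eq_bigr => k _.
have -> : vals [tuple of k :: t] = [tuple of val k :: vals t] by apply: val_inj.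
by rewrite chain_weight_cons {1 2}/part /=; ring.
Qed.

Lemma chain_weight_neq0_sorted m (t : m.-tuple nat) :
  chain_weight q t != 0 -> sorted leq t.
Proof.
move=> nz; apply/(sortedP 0%N) => i; rewrite size_tuple => lt_im.
rewrite leqNgt; apply: contra nz => desc.
rewrite /chain_weight (bigD1_seq i.+1) ?mem_index_iota ?iota_uniq //=.
by rewrite qbinom_gt // mulr0 mul0r.
Qed.

(** The summand vanishes on unsorted tuples, through a zero q-binomial, and on
    sorted tuples whose last entry is at least N, through (q)_(n_m) = 0.  So the
    sum is carried by the tuples with all entries below N. *)
Lemma fsum_chains m (a b : nat -> F) : (0 < N)%N -> N.-unity_root q ->
  \sum_(t \in chains m.+1)
     (qfact q (part t m.+1) * b (part t m.+1) * a (part t 1) * chain_weight q t)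
  = \sum_(n < N) qfact q n * b n * iter m (bailey_step q) a n.
Proof.
move=> N0 qN.
rewrite -(sum_tuple_bailey_step _ _ (fun n => qfact q n * b n)).
rewrite (fsbig_widen _ setT) //; last first.
  move=> t [_ /= unsorted]; apply/eqP; apply: contra_notT unsorted => nz.
  apply: chain_weight_neq0_sorted.
  by apply: contraNneq nz => ->; rewrite mulr0.
have vals_inj : injective (@vals m.+1).
  move=> s t /(congr1 val) /= st; apply: val_inj; apply: inj_map st.
  exact: val_inj.
rewrite (fsbigE [seq vals t | t : m.+1.-tuple 'I_N]) //; first last.
- move=> t _; apply: contraNeq => nz; apply/mapP.
  have lastN : (part t m.+1 < N)%N.
    rewrite ltnNge; apply: contra nz => /(qfact_unity_root N0 qN) ->.
    by rewrite !mul0r.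
  have /chain_weight_neq0_sorted sorted_t : chain_weight q t != 0.
    by apply: contraNneq nz => ->; rewrite mulr0.
  have ltN i : (tnth t i < N)%N.
    apply: leq_ltn_trans lastN; rewrite (tnth_nth 0%N).
    apply: (sorted_leq_nth leq_trans leqnn) => //; rewrite ?inE ?size_tuple //.
    by rewrite -ltnS.
  exists [tuple Ordinal (ltN i) | i < m.+1]; first by rewrite mem_enum.
  by apply: eq_from_tnth => i; rewrite tnth_map tnth_mktuple.
- by rewrite map_inj_uniq // enum_uniq.
rewrite (eq_bigl xpredT) => [|t]; last by rewrite in_setT.
by rewrite big_map big_enum.
Qed.
End ChainSums.

Theorem theorem1p1 (R : realType) (m : nat) (hm : (1 <= m)%N)
    (q : R[i]) (N : nat) (hN : (0 < N)%N) (hq : N.-unity_root q) :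
  \sum_(n \in chains m)
     (qfact q (part n m) * (-1) ^+ part n 1 * q ^- 'C((part n 1).+1, 2)
        * chain_weight q n)
  = \sum_(n \in chains m)
     (qfact q (part n m) * qfact q (part n 1) * q ^+ (part n m).+1
        * chain_weight q n).
Proof.
case: m hm => // m _.
have q0 : q != 0.
  apply: contraTneq hq => ->.
  by rewrite unity_rootE expr0n gtn_eqF // eq_sym oner_eq0.
pose f k := (-1) ^+ k * q ^- 'C(k.+1, 2).
transitivity (\sum_(n < N) qfact q n * 1 * iter m (bailey_step q) f n).
  rewrite -(fsum_chains m f (fun=> 1)) //.
  by apply: eq_fsbigr => t _; rewrite /f mulr1 !mulrA.
transitivity (\sum_(n < N) qfact q n * q ^+ n.+1 * iter m (bailey_step q) (qfact q) n);
  last first.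
  rewrite -(fsum_chains m (qfact q) (fun n => q ^+ n.+1)) //.
  by apply: eq_fsbigr => t _; congr (_ * _); rewrite mulrAC.
(* On the right the m steps are applied to M f = (q)_., so that side
   carries m + 1 steps applied to [f]; its last step is the one that the factor
   q^(n+1) absorbs. *)
have step_f : bailey_step q (iter m (bailey_step q) f) =1 iter m (bailey_step q) (qfact q).
  move=> n; rewrite -iterS iterSr; elim: m n => [|m IHm] n /=.
    exact: bailey_step_alternating.
  exact: eq_bailey_step.
have qfN : qfact q N = 0 by apply: qfact_unity_root hq _.
under [RHS]eq_bigr => n _ do rewrite -step_f (@bailey_step_ord _ _ N) // mulr_sumr.
rewrite exchange_big; apply: eq_bigr => k _.
rewrite mulr1 -{1}(sum_last_bailey_step k qfN) mulr_sumr mulr_suml.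
by apply: eq_bigr => n _; ring.
Qed.
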